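(* Let $1 \le k \le n$ be integers, let $\mathbb{H} \subset \mathbb{C}$ be a closed half-plane, and let $\ell_1,\dots,\ell_k \in \mathbb{C}[Z_1,\dots,Z_n]$ be linear forms. Let $V \subset \mathbb{C}^n$ be an algebraic set defined as the common zero set of $(\ell_1,\dots,\ell_k)$-sufficient symmetric polynomials in $\mathbb{C}[X_1,\dots,X_n]$. Then $V \cap \mathbb{H}^n = \emptyset$ if and only if $V \cap \mathbb{H}_{2(k+2),\,k+2} = \emptyset$.
   Context: Let $e_1,\dots,e_n$ be the elementary symmetric polynomials in $X_1,\dots,X_n$. Every symmetric $f \in \mathbb{C}[X_1,\dots,X_n]$ can be written as $f = g(e_1,\dots,e_n)$ for a unique $g \in \mathbb{C}[Z_1,\dots,Z_n]$. Given linear forms $\ell_1,\dots,\ell_k \in \mathbb{C}[Z_1,\dots,Z_n]$, the polynomial $f$ is called $(\ell_1,\dots,\ell_k)$-sufficient if $g$ lies in the subalgebra $\mathbb{C}[\ell_1,\dots,\ell_k]$. For a closed half-plane $\mathbb{H} \subset \mathbb{C}$ with boundary line $\operatorname{bd}\mathbb{H}$ and interior $\operatorname{int}\mathbb{H}$, and nonnegative integers $p,q$, define $$\mathbb{H}_{p,q} := \left\{ x \in \mathbb{H}^n : |\{x_1,\dots,x_n\} \cap \operatorname{bd}\mathbb{H}| \le p \text{ and } |\{ j \in \{1,\dots,n\} : x_j \in \operatorname{int}\mathbb{H} \}| \le q \right\}.$$ *)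

(* Defs.v *)
From mathcomp Require Import all_boot all_order all_algebra.
From mathcomp Require Import boolp classical_sets reals.
From mathcomp Require Import complex mpoly.

Set Implicit Arguments.
Unset Strict Implicit.
Unset Printing Implicit Defensive.

Import Order.TTheory GRing.Theory Num.Theory.

Local Open Scope classical_set_scope.
Local Open Scope complex_scope.
Local Open Scope ring_scope.

(* The i-th component (i < n) is e_(i+1). *)
Definition elem_sym_tuple (R : realType) (n : nat) :
    n.-tuple {mpoly R[i][n]} :=
  [tuple mesym n R[i] i.+1 | i < n].

(* C[l_1, ..., l_k]: all polynomial expressions in the l_i. *)
Definition gen_subalgebra (R : realType) (n k : nat)
    (l : k.-tuple {mpoly R[i][n]}) : set {mpoly R[i][n]} :=
  range (fun h : {mpoly R[i][k]} => h \mPo l).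

(* The polynomial g is unique, since the e_i are algebraically independent. *)
Definition sufficient (R : realType) (n k : nat)
    (l : k.-tuple {mpoly R[i][n]}) (f : {mpoly R[i][n]}) : Prop :=
  f \is symmetric /\
  exists g : {mpoly R[i][n]},
    f = g \mPo elem_sym_tuple R n /\ gen_subalgebra l g.

Definition zero_locus (R : realType) (n : nat) (F : set {mpoly R[i][n]}) :
    set (n.-tuple R[i]) :=
  [set x | forall f, F f -> f.@[tnth x] = 0].

(* The closed half-plane {z | Re (a z) >= c}; every closed half-plane of C has
   this form for some a != 0 and some real c. *)
Record half_plane (R : realType) := HalfPlane {
  hp_coef : R[i];
  hp_level : R;
  hp_coef_neq0 : hp_coef != 0
}.

Definition hp_set (R : realType) (H : half_plane R) : set R[i] :=
  [set z | hp_level H <= complex.Re (hp_coef H * z)].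

Definition hp_bd (R : realType) (H : half_plane R) : set R[i] :=
  [set z | complex.Re (hp_coef H * z) = hp_level H].

Definition hp_int (R : realType) (H : half_plane R) : set R[i] :=
  [set z | hp_level H < complex.Re (hp_coef H * z)].

Definition hp_power (R : realType) (n : nat) (H : half_plane R) :
    set (n.-tuple R[i]) :=
  [set x | forall j, hp_set H (tnth x j)].

(* Boundary entries are counted as distinct values (undup), interior entries
   as indices, that is, with multiplicity. *)
Definition hp_bounded (R : realType) (n : nat) (H : half_plane R)
    (p q : nat) : set (n.-tuple R[i]) :=
  [set x | [/\ hp_power H x,
               (size (undup [seq z <- x | z \in hp_bd H]) <= p)%N &
               (#|[set j : 'I_n | tnth x j \in hp_int H]%SET| <= q)%N]].

(* Main.v *)
(* An affine change of variable turns the half-plane into {Im z >= 0}. Besides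
   the k linear conditions on the coefficients of the monic polynomial
   F = \prod_j (X - x_j), fix the two coefficients following the leading one,
   that is, \sum_j x_j and \sum_j x_j^2: the fiber of root vectors in the closed
   half-plane is then compact. Take a point of the fiber where the sum of the
   squared moduli of the coefficients of F is maximal. By the parallelogram
   identity there is no g <> 0 of degree < n, killed by the K = k + 2 linear
   conditions, such that both F + g and F - g have all their roots in the
   half-plane. But such a g exists if F has
   - m > K interior roots, with product Q: take g = (F / Q) h where deg h < m
     (m complex unknowns for K equations) and h is small;
   - m > 2K distinct real roots r_i, with product Q: take g = (F / Q) h where
     h = \sum_i a_i Q / (X - r_i) with small real a_i (m real unknowns for 2K
     real equations); as Q has simple real roots, so has Q + h. *)
Require Import Defs.
From HB Require Import structures.
From mathcomp Require Import all_boot all_order all_algebra.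
From mathcomp Require Import boolp classical_sets reals.
From mathcomp Require Import complex mpoly.
From mathcomp Require Import ring lra.
(* The notations of these files clash with those of [mpoly]. *)
From mathcomp Require Import -(notations) functions topology normedtype derive.

Set Implicit Arguments.
Unset Strict Implicit.
Unset Printing Implicit Defensive.

Import Order.TTheory GRing.Theory Num.Theory numFieldNormedType.Exports.

Local Open Scope classical_set_scope.
Local Open Scope complex_scope.
Local Open Scope ring_scope.

Local Notation root_prod s := (\prod_(z <- s) ('X - z%:P)).

(** * Kernel vectors and finite minima *)

Lemma exists_row_kernel (F : fieldType) (m K : nat) (A : 'M[F]_(m, K)) :
  (K < m)%N -> exists2 u : 'rV[F]_m, u != 0 & u *m A = 0.
Proof.
move=> ltKm; have : kermx A != 0.
  by rewrite kermx_eq0 /row_free eqn_leq [(m <= _)%N]leqNgt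
    (leq_ltn_trans (rank_leq_col A) ltKm) andbF.
case/rowV0Pn=> u /sub_kermxP uA u0; by exists u.
Qed.

Lemma exists_pos_lower_bound (F : realFieldType) (I : finType) (P : pred I)
    (f : I -> F) :
  (forall i, P i -> 0 < f i) ->
  exists2 d : F, 0 < d & forall i, P i -> d <= f i.
Proof.
move=> f0; exists (\big[Order.min/1]_(i | P i) f i).
  by apply/lt_bigmin.
by move=> i Pi; apply: bigmin_le_cond.
Qed.

(** * Real perturbations of a sum of simple fractions *)

Section RealEstimate.
Variables (R : rcfType) (m : nat) (r a : 'I_m -> R).
Hypothesis r_inj : injective r.

(* Real and imaginary part of [1 + e * \sum_i a i / (z - r i)] at
   [z = x + i y]. If both vanish, the pole nearest to [z] is at distance O(e),
   and then its term dominates the imaginary part. *)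
Lemma perturbed_fraction_neq0 :
  exists2 eps : R, 0 < eps & forall e x y : R, `|e| <= eps -> y != 0 ->
    \sum_i a i / ((x - r i) ^+ 2 + y ^+ 2) = 0 ->
    1 + e * (\sum_i a i * (x - r i) / ((x - r i) ^+ 2 + y ^+ 2)) != 0.
Proof.
have [al al0 alP] : exists2 al : R, 0 < al & forall i, a i != 0 -> al <= `|a i|.
  by apply: exists_pos_lower_bound => i; rewrite normr_gt0.
(* [de] is at most a quarter of every squared gap between poles, hence a lower bound for the squared
   distance to every pole except the nearest. *)
have [de de0 deP] : exists2 de : R, 0 < de &
    forall p : 'I_m * 'I_m, p.1 != p.2 -> de <= (r p.1 - r p.2) ^+ 2 / 4.
  apply: exists_pos_lower_bound => -[i j] /= ij.
  by rewrite divr_gt0 // exprn_even_gt0 //= subr_eq0 (inj_eq r_inj).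
pose A := \sum_i `|a i|.
have A0 : 0 <= A by apply: sumr_ge0 => i _.
have A30 : 0 <= A ^+ 3 by rewrite exprn_ge0.
have ad0 : 0 < al * de by rewrite mulr_gt0.
(* Chosen so that [eps ^+ 2 * A ^+ 3 < al * de], the reverse of what a common zero forces at the
   end. *)
pose eps := al * de / (A ^+ 3 + al * de).
have den0 : 0 < A ^+ 3 + al * de by lra.
have eps0 : 0 < eps by rewrite divr_gt0.
have eps1 : eps <= 1 by rewrite ler_pdivrMr // mul1r; lra.
have epsA : eps ^+ 2 * A ^+ 3 < al * de.
  apply: (@le_lt_trans _ _ (eps * A ^+ 3)).
    by rewrite ler_wpM2r // expr2 ler_piMl // ltW.
  rewrite /eps mulrAC ltr_pdivrMr // ltr_pM2l //; lra.
exists eps => // e x y ele y0 sum0; apply/negP=> /eqP one0.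
pose D i := (x - r i) ^+ 2 + y ^+ 2.
have D0 i : 0 < D i by rewrite ltr_wpDl ?sqr_ge0 // exprn_even_gt0.
case: (pickP (fun i => a i != 0)) => [i0 ai0|a0]; last first.
  have : (1 : R) = 0; last by move/eqP; rewrite oner_eq0.
  rewrite -one0 big1 ?mulr0 ?addr0 // => i _.
  by move/negbFE/eqP: (a0 i) => ->; rewrite !mul0r.
have [i ai iP] := @arg_minP _ _ _ i0 (fun i => a i != 0) D ai0.
pose d := Num.sqrt (D i).
have d0 : 0 < d by rewrite sqrtr_gt0.
have dD : d ^+ 2 = D i by rewrite sqr_sqrtr // ltW.
(* The real part vanishes, so 1 is at most [eps] times the sum of the [|a j| |x - r j| / D j], and
   each [|x - r j| / D j] is at most [1 / d]. *)
have dle : d <= eps * A.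
  have bd : `|\sum_i a i * (x - r i) / D i| <= A / d.
    apply: (le_trans (ler_norm_sum _ _ _)); rewrite mulr_suml.
    apply: ler_sum => j _; case: (eqVneq (a j) 0) => [->|aj].
      by rewrite !mul0r normr0 mul0r.
    rewrite -mulrA normrM ler_wpM2l // normrM normfV (gtr0_norm (D0 j)).
    have sj : 0 < Num.sqrt (D j) by rewrite sqrtr_gt0.
    have sD : Num.sqrt (D j) ^+ 2 = D j by rewrite sqr_sqrtr // ltW.
    have xs : `|x - r j| <= Num.sqrt (D j).
      by rewrite -sqrtr_sqr ler_wsqrtr // /D lerDl sqr_ge0.
    have ds : d <= Num.sqrt (D j) by rewrite ler_wsqrtr // iP.
    rewrite ler_pdivrMr // mulrC ler_pdivlMr // -sD expr2.
    by apply: ler_pM => //; apply: ltW.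
  have h : 1 <= eps * (A / d).
    have -> : (1 : R) = `|e * (\sum_i a i * (x - r i) / D i)|.
      move/eqP: one0; rewrite addrC addr_eq0 => /eqP ->.
      by rewrite normrN normr1.
    by rewrite normrM; apply: ler_pM.
  by rewrite mulrA ler_pdivlMr // mul1r in h.
(* The squared gap between [r j] and [r i] is at most [2 (D i + D j)], hence at most [4 D j] as
   [D i] is minimal. *)
have Dge j : j != i -> a j != 0 -> de <= D j.
  move=> ji aj; have := deP (j, i) ji; have := iP j aj => /=.
  rewrite /D; have := sqr_ge0 y.
  have := sqr_ge0 ((x - r j) + (x - r i)); nra.
(* The vanishing imaginary part makes the nearest term equal, up to sign, to the sum of the others,
   whose poles are far away. *)
have key : al / D i <= A / de.
  move: sum0; rewrite (bigD1 i) //= => /eqP; rewrite addr_eq0 => /eqP E.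
  apply: (@le_trans _ _ `|a i / D i|).
    by rewrite normrM normfV (gtr0_norm (D0 i)) ler_wpM2r ?alP // invr_ge0 ltW.
  rewrite E normrN; apply: (le_trans (ler_norm_sum _ _ _)).
  rewrite mulr_suml [leRHS](bigD1 i) //= ler_wpDl //.
    by rewrite divr_ge0 // ltW.
  apply: ler_sum => j ji; case: (eqVneq (a j) 0) => [->|aj].
    by rewrite !mul0r normr0 mul0r.
  rewrite normrM normfV (gtr0_norm (D0 j)) ler_wpM2l //.
  by rewrite lef_pV2 ?posrE // Dge.
rewrite ler_pdivrMr // mulrAC ler_pdivlMr // -dD in key.
have d2 : d ^+ 2 <= (eps * A) ^+ 2.
  by rewrite lerXn2r // nnegrE ?(ltW d0) // mulr_ge0 // ltW.
have := le_trans key (ler_wpM2l A0 d2).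
have -> : A * (eps * A) ^+ 2 = eps ^+ 2 * A ^+ 3 by ring.
by rewrite leNgt epsA.
Qed.

End RealEstimate.

(** * Perturbations that keep all roots in the closed upper half-plane *)

Section Polynomials.
Variable R : realType.
Local Notation C := R[i].

Lemma le_Im_normc (z : C) : `|complex.Im z|%:C <= `|z|.
Proof. by rewrite normc_def lecR -sqrtr_sqr ler_wsqrtr // lerDr sqr_ge0. Qed.

Lemma ImB (x y : C) : complex.Im (x - y) = complex.Im x - complex.Im y.
Proof. by case: x y => [a b] [c d]. Qed.

Lemma le_Im_normB (x z : C) : 0 < complex.Im x -> complex.Im z <= 0 ->
  (complex.Im x)%:C <= `|z - x|.
Proof.
move=> x0 z0; apply: le_trans (le_Im_normc _).
rewrite lecR ImB ler0_norm; lra.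
Qed.

(** On the closed lower half-plane each factor [z - x] has modulus at least [Im x], so [E] can be
    the inverse of the product of these imaginary parts. *)
Lemma root_prod_lower_bound (s : seq C) :
  (forall x, x \in s -> 0 < complex.Im x) ->
  exists2 E : C, 0 <= E &
    forall z, complex.Im z <= 0 -> 1 <= E * `|(root_prod s).[z]|.
Proof.
elim: s => [|x s IHs] s0.
  by exists 1 => // z _; rewrite big_nil hornerC normr1 mulr1.
have [|E E0 EP] := IHs; first by move=> y ys; rewrite s0 // in_cons ys orbT.
have x0 : 0 < complex.Im x by rewrite s0 // in_cons eqxx.
have x0C : 0 < (complex.Im x)%:C :> C by rewrite -[0]/(0%:C) ltcR.
exists (E / (complex.Im x)%:C) => [|z z0].
  by rewrite divr_ge0 // ltW.
rewrite big_cons hornerM normrM hornerXsubC.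
set u := `|z - x|; set v := `|_|.
have -> : E / (complex.Im x)%:C * (u * v) = (u / (complex.Im x)%:C) * (E * v).
  by ring.
by rewrite mulr_ege1 ?EP // ler_pdivlMr // mul1r le_Im_normB.
Qed.

(** Induction through division by [X - x]: the quotient is handled by the shorter list, the constant
    remainder by the lower bound on the root product. *)
Lemma poly_dominated_by_root_prod (s : seq C) (h : {poly C}) :
  (forall x, x \in s -> 0 < complex.Im x) -> (size h <= size s)%N ->
  exists2 B : C, 0 <= B &
    forall z, complex.Im z <= 0 -> `|h.[z]| <= B * `|(root_prod s).[z]|.
Proof.
elim: s h => [|x s IHs] h s0 hs.
  move: hs; rewrite size_poly_leq0 => /eqP ->; exists 0 => // z _.
  by rewrite horner0 normr0 mul0r.
have [E E0 EP] := root_prod_lower_bound s0.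
have [p hp] : exists p, h - (h.[x])%:P = p * ('X - x%:P).
  by apply/factor_theorem; rewrite /root !hornerE subrr.
have [||B B0 BP] := IHs p.
- by move=> y ys; rewrite s0 // in_cons ys orbT.
- have : (size (h - (h.[x])%:P)%R <= size (x :: s))%N.
    apply: (leq_trans (size_polyD _ _)); rewrite geq_max hs size_polyN.
    by apply: leq_trans (size_polyC_leq1 _) _.
  rewrite hp; have [->|p0] := eqVneq p 0; first by rewrite size_poly0.
  by rewrite size_Mmonic ?monicXsubC // size_XsubC addn2.
exists (B + `|h.[x]| * E) => [|z z0]; first by rewrite addr_ge0 // mulr_ge0.
have -> : h.[z] = p.[z] * (z - x) + h.[x].
  by rewrite -hornerXsubC -hornerM -hp !hornerE subrK.
rewrite mulrDl; apply: (le_trans (ler_normD _ _)); apply: lerD.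
  rewrite big_cons hornerM !normrM hornerXsubC mulrCA mulrC.
  by rewrite ler_wpM2l // BP.
by rewrite -mulrA -[leLHS]mulr1 ler_wpM2l // EP.
Qed.

(** The size bound makes the degree of [g] smaller than that of [root_prod s], so both perturbed
    polynomials stay monic of the same degree. *)
Definition two_sided_direction (s : seq C) (g : {poly C}) : Prop :=
  [/\ g != 0, (size g <= size s)%N &
    forall z, root (root_prod s + g) z || root (root_prod s - g) z ->
      0 <= complex.Im z].

(** For [Q = root_prod s] and [e = 1 / (B + 1)], a root [z] in the open lower half-plane would give
    [|Q(z)| = |e h(z)| <= B / (B + 1) * |Q(z)|] with [Q(z)] nonzero. *)
Lemma root_prod_perturb_interior (s : seq C) (h : {poly C}) :
  (forall x, x \in s -> 0 < complex.Im x) -> (size h <= size s)%N ->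
  exists2 e : C, e != 0 & forall z,
    root (root_prod s + e *: h) z || root (root_prod s - e *: h) z ->
      0 <= complex.Im z.
Proof.
move=> s0 hs; have [B B0 BP] := poly_dominated_by_root_prod s0 hs.
have B1 : 0 < B + 1 by rewrite ltr_wpDl.
exists (B + 1)^-1 => [|z]; first by rewrite invr_eq0 gt_eqF.
move=> rt; rewrite leNgt; apply/negP => z0.
have nQ : `|(root_prod s).[z]| = `|(B + 1)^-1 * h.[z]|.
  case/orP: rt => /rootP; rewrite !hornerE => /eqP.
    by rewrite addr_eq0 => /eqP ->; rewrite normrN.
  by rewrite subr_eq0 => /eqP ->.
have Q0 : 0 < `|(root_prod s).[z]|.
  rewrite normr_gt0 -[_ == 0]/(root _ z) root_prod_XsubC.
  by apply/negP => /s0; rewrite ltNge (ltW z0).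
suff lth : B * `|(root_prod s).[z]| < `|h.[z]|.
  by have := BP z (ltW z0); rewrite (lt_geF lth).
move: nQ; rewrite normrM gtr0_norm ?invr_gt0 // => nQ.
have -> : `|h.[z]| = (B + 1) * `|(root_prod s).[z]|.
  by rewrite nQ mulrA divff ?mul1r // gt_eqF.
by rewrite ltr_pM2r // ltrDl.
Qed.

Lemma two_sided_direction_mul (s s1 : seq C) (P h : {poly C}) :
  (forall x, x \in s -> 0 <= complex.Im x) ->
  root_prod s = P * root_prod s1 ->
  two_sided_direction s1 h -> two_sided_direction s (P * h).
Proof.
move=> s0 sE [h0 hs hr].
have PQ0 : P * root_prod s1 != 0 by rewrite -sE monic_neq0 ?monic_prod_XsubC.
have P0 : P != 0 by apply: contraNneq PQ0 => ->; rewrite mul0r.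
have Ps : (size P + size s1 = (size s).+1)%N.
  have /(congr1 (fun p : {poly C} => size p)) := sE.
  by rewrite size_Mmonic ?monic_prod_XsubC // !size_prod_XsubC addnS /= => ->.
split => [||z]; first by rewrite mulf_neq0.
  rewrite size_mul // -ltnS prednK ?addn_gt0 ?size_poly_gt0 ?P0 //.
  by rewrite -Ps leq_add2l.
rewrite sE -mulrDr -mulrBr !rootM; case: (boolP (root P z)) => [Pz _|_] /=.
  by apply: s0; rewrite -root_prod_XsubC sE rootM Pz.
exact: hr.
Qed.

Lemma interior_direction (K : nat) (L : {linear {poly C} -> 'rV[C]_K})
    (s : seq C) :
  (forall x, x \in s -> 0 <= complex.Im x) ->
  (K < count (fun x : C => (0 < complex.Im x)%R) s)%N ->
  exists2 g, two_sided_direction s g & L g = 0.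
Proof.
move=> s0; set pr := (fun x : C => _); rewrite -size_filter => Km.
set s1 := seq.filter pr s in Km; set s2 := seq.filter (predC pr) s.
have sE : root_prod s = root_prod s2 * root_prod s1.
  by rewrite !big_filter mulrC [LHS](bigID pr).
(* A left kernel vector of [A] is the coefficient list of some [h] with
   [L (root_prod s2 * h) = 0]. *)
pose A := \matrix_(i < size s1) L (root_prod s2 * 'X^i).
have [u u0 uA] := exists_row_kernel A Km.
have hs : (size (rVpoly u) <= size s1)%N by apply: size_poly.
have h0 : rVpoly u != 0.
  by apply: contra u0 => /eqP h0; rewrite -[u]rVpolyK h0 linear0.
have L0 : L (root_prod s2 * rVpoly u) = 0.
  rewrite -uA mulmx_sum_row -[rVpoly u]/(\poly_(i < _) _) poly_def mulr_sumr.
  rewrite linear_sum; apply: eq_bigr => i _.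
  by rewrite rowK -scalerAr linearZ -coef_rVpoly_ord coef_rVpoly.
have [|e e0 eP] := root_prod_perturb_interior _ hs.
  by move=> x; rewrite mem_filter => /andP[].
exists (root_prod s2 * (e *: rVpoly u)); last first.
  by rewrite -scalerAr linearZ /= L0 scaler0.
apply: (two_sided_direction_mul s0 sE); split=> //.
  by rewrite scaler_eq0 negb_or e0.
by rewrite (leq_trans (size_scale_leq _ _)).
Qed.

Lemma boundary_direction (K : nat) (L : {linear {poly C} -> 'rV[C]_K})
    (s : seq C) :
  (forall x, x \in s -> 0 <= complex.Im x) ->
  (2 * K < size (undup [seq x <- s | complex.Im x == 0%R]))%N ->
  exists2 g, two_sided_direction s g & L g = 0.
Proof.
move=> s0; set s1 := undup _ => Km.
set m := size s1 in Km.
pose r (i : 'I_m) := complex.Re s1`_i.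
have rE i : (r i)%:C = s1`_i.
  have : s1`_i \in s1 by rewrite mem_nth.
  rewrite mem_undup mem_filter /r; case: (s1`_i) => x y.
  by case/andP => /= /eqP ->.
have r_inj : injective r.
  move=> i j rij; apply: val_inj; apply/eqP.
  by rewrite -(nth_uniq 0 (ltn_ord i) (ltn_ord j) (undup_uniq _)) -!rE rij.
have s1E : root_prod s1 = \prod_i ('X - (r i)%:C%:P).
  by rewrite (big_nth 0) big_mkord; apply: eq_bigr => i _; rewrite rE.
have [P sE] : exists P, root_prod s = P * root_prod s1.
  apply/dvdpP/uniq_roots_dvdp.
    apply/allP => x; rewrite mem_undup mem_filter => /andP[_ xs].
    by rewrite root_prod_XsubC.
  by rewrite uniq_rootsE undup_uniq.
pose Q i := \prod_(j | j != i) ('X - (r j)%:C%:P).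
have QE i : root_prod s1 = ('X - (r i)%:C%:P) * Q i by rewrite s1E (bigD1 i).
(* The weights must be real, so each complex equation is split into its real and imaginary parts. *)
pose A := \matrix_(i < m) row_mx (map_mx (@complex.Re R) (L (P * Q i)))
                                 (map_mx (@complex.Im R) (L (P * Q i))).
have [|a a0 aA] := exists_row_kernel A; first by rewrite addnn -mul2n.
pose h := \sum_i (a 0 i)%:C *: Q i.
(* As in Lagrange interpolation, only one term survives at [r i]; hence [h = 0] would force all
   weights to vanish. *)
have hr i : h.[(r i)%:C] = (a 0 i)%:C * (Q i).[(r i)%:C].
  rewrite /h horner_sum (bigD1 i) //= big1 ?addr0 ?hornerZ // => j ji.
  rewrite hornerZ /Q (bigD1 i) 1?eq_sym //= hornerM hornerXsubC subrr.
  by rewrite mul0r mulr0.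
have h0 : h != 0.
  apply: contra a0 => /eqP h0; apply/eqP/rowP => i; rewrite mxE.
  move: (hr i); rewrite h0 horner0 => /esym/eqP.
  rewrite mulf_eq0 => /orP[/eqP[->//]|].
  rewrite horner_prod prodf_seq_eq0 => /hasP[j _ /andP[ji]].
  rewrite hornerXsubC subr_eq0 => /eqP/complexI/r_inj ij.
  by rewrite ij eqxx in ji.
have hs : (size h <= size s1)%N.
  apply: (leq_trans (size_sum _ _ _)); apply/bigmax_leqP => i _.
  apply: (leq_trans (size_scale_leq _ _)).
  have Q0 : Q i != 0.
    have : root_prod s1 != 0 by rewrite monic_neq0 ?monic_prod_XsubC.
    by apply: contraNneq => Q0; rewrite (QE i) Q0 mulr0.
  have /(congr1 (fun p : {poly C} => size p)) := QE i.
  rewrite size_prod_XsubC size_monicM ?monicXsubC // size_XsubC => -[->].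
  by [].
have L0 : L (P * h) = 0.
  apply/rowP => q; rewrite mxE mulr_sumr linear_sum summxE.
  rewrite (eq_bigr (fun i => (a 0 i * complex.Re (L (P * Q i) 0 q))%:C +
      'i * (a 0 i * complex.Im (L (P * Q i) 0 q))%:C)) => [|i _]; last first.
    rewrite -scalerAr linearZ mxE {1}[L _ 0 q]complexE mulrDr mulrCA.
    by rewrite -!rmorphM.
  rewrite big_split /= -mulr_sumr -!rmorph_sum /=.
  move/rowP: aA => aA.
  have -> : \sum_i a 0 i * complex.Re (L (P * Q i) 0 q) = 0.
    move: (aA (lshift K q)); rewrite !mxE; apply: etrans.
    by apply: eq_bigr => i _; rewrite [A i _]mxE row_mxEl [in RHS]mxE.
  have -> : \sum_i a 0 i * complex.Im (L (P * Q i) 0 q) = 0.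
    move: (aA (rshift K q)); rewrite !mxE; apply: etrans.
    by apply: eq_bigr => i _; rewrite [A i _]mxE row_mxEr [in RHS]mxE.
  by rewrite mulr0 addr0.
have [eps eps0 epsP] := perturbed_fraction_neq0 (a 0) r_inj.
exists (P * (eps%:C *: h)); last by rewrite -scalerAr linearZ /= L0 scaler0.
apply: (two_sided_direction_mul s0 sE); split.
- by rewrite scaler_eq0 negb_or h0 andbT (inj_eq (@complexI _) _ 0) gt_eqF.
- by rewrite (leq_trans (size_scale_leq _ _)).
move=> z rt; rewrite leNgt; apply/negP => z0.
set x := complex.Re z; set y := complex.Im z in z0.
pose D i := (x - r i) ^+ 2 + y ^+ 2.
have D0 i : D i != 0.
  by rewrite gt_eqF // ltr_wpDl ?sqr_ge0 // exprn_even_gt0 //= lt_eqF.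
have zr i : z - (r i)%:C != 0.
  by rewrite subr_eq0; apply/eqP => zr; move: z0; rewrite /y zr ltxx.
(* The estimate depends only on [|e|], so both signs are treated together. *)
have [e ele eP] : exists2 e : R, `|e| = eps &
    root (root_prod s1 + e%:C *: h) z.
  case/orP: rt => rt; first by exists eps => //; rewrite gtr0_norm.
  by exists (- eps); rewrite ?normrN ?gtr0_norm // rmorphN scaleNr.
have e0 : e != 0 by rewrite -normr_eq0 ele gt_eqF.
have Qz i : (Q i).[z] = (root_prod s1).[z] / (z - (r i)%:C).
  by rewrite (QE i) hornerM hornerXsubC mulrAC divff ?mul1r.
have Qz0 : (root_prod s1).[z] != 0.
  by rewrite s1E horner_prod; apply/prodf_neq0 => i _; rewrite hornerXsubC.
have zV i : (z - (r i)%:C)^-1 = ((x - r i) / D i)%:C - 'i * (y / D i)%:C.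
  apply: (mulfI (zr i)); rewrite divff //.
  rewrite [z]complexE -/x -/y; apply/eqP; rewrite eq_complex /=.
  by apply/andP; split; apply/eqP; rewrite /D; field; apply: D0.
(* Dividing by the nonzero value of [root_prod s1] at [z] turns the root equation into one on
   partial fractions. *)
have : 1 + e%:C * \sum_i (a 0 i)%:C * (z - (r i)%:C)^-1 = 0.
  apply: (mulfI Qz0); rewrite mulr0 -[RHS](rootP eP) hornerD hornerZ.
  rewrite mulrDr mulr1.
  congr (_ + _); rewrite mulrCA; congr (_ * _).
  rewrite mulr_sumr /h horner_sum; apply: eq_bigr => i _.
  by rewrite hornerZ Qz mulrCA.
rewrite (eq_bigr (fun i => (a 0 i * (x - r i) / D i)%:C -
    'i * (y * (a 0 i / D i))%:C)) => [|i _]; last first.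
  rewrite zV mulrBr mulrCA -!rmorphM /=.
  by rewrite [a 0 i * ((x - _) / _)]mulrA [a 0 i * (y / _)]mulrCA.
rewrite sumrB -mulr_sumr -!rmorph_sum -mulr_sumr /= => /eqP.
rewrite eq_complex /= => /andP[/eqP reE /eqP imE].
have y0 : y != 0 by rewrite lt_eqF.
have sum0 : \sum_i a 0 i / D i = 0.
  suff /eqP : e * (y * (\sum_i a 0 i / D i)) = 0.
    by rewrite !mulf_eq0 (negPf e0) (negPf y0) => /eqP.
  move: imE; lra.
have /eqP[] : 1 + e * \sum_i a 0 i * (x - r i) / D i != 0.
  by apply: epsP => //; rewrite ele.
move: reE; lra.
Qed.

End Polynomials.

(** * Coefficient energy, and power sums of the roots *)

Section Descent.
Variable R : realType.
Local Notation C := R[i].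

Definition sqnorm (z : C) : R := complex.Re z ^+ 2 + complex.Im z ^+ 2.

Lemma sqnorm_gt0 z : z != 0 -> 0 < sqnorm z.
Proof.
case: z => a b z0; rewrite lt_neqAle addr_ge0 ?sqr_ge0 // andbT eq_sym.
by rewrite paddr_eq0 ?sqr_ge0 // !sqrf_eq0; move: z0; rewrite eq_complex.
Qed.

Lemma sqnorm_parallelogram (x y : C) :
  sqnorm (x + y) + sqnorm (x - y) = (sqnorm x + sqnorm y) *+ 2.
Proof. by case: x y => [a b] [c d]; rewrite /sqnorm /=; ring. Qed.

Definition coef_energy (n : nat) (p : {poly C}) : R :=
  \sum_(i < n) sqnorm p`_i.

(** Summed over the coefficients, the parallelogram identity leaves a surplus of twice the energy of
    [g], positive because of its leading coefficient. *)
Lemma coef_energy_parallelogram n (p g : {poly C}) :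
  g != 0 -> (size g <= n)%N ->
  (coef_energy n p) *+ 2 < coef_energy n (p + g) + coef_energy n (p - g).
Proof.
move=> g0 gn; rewrite -big_split /= -sumrMnl.
have j0 : ((size g).-1 < n)%N by rewrite prednK ?size_poly_gt0.
rewrite (bigD1 (Ordinal j0)) //= [ltRHS](bigD1 (Ordinal j0)) //=.
rewrite ltr_leD //; last first.
  apply: ler_sum => i _; rewrite coefD coefB sqnorm_parallelogram lerMn2r /=.
  by rewrite lerDl addr_ge0 ?sqr_ge0.
rewrite coefD coefB sqnorm_parallelogram ltrMn2r /= ltrDl sqnorm_gt0 //.
by rewrite -[_`__]/(lead_coef g) lead_coef_eq0.
Qed.

Lemma monic_perturb_root_prod (s : seq C) (g : {poly C}) :
  (size g <= size s)%N ->
  exists2 t, root_prod s + g = root_prod t & size t = size s.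
Proof.
move=> gs; have [t tE] := closed_field_poly_normal (root_prod s + g).
have sg : (size g < size (root_prod s))%N by rewrite size_prod_XsubC.
move: tE; rewrite lead_coefDl // (monicP (monic_prod_XsubC _ _ _)) scale1r.
move=> tE.
exists t => //; apply: succn_inj.
rewrite -(size_prod_XsubC t id) -(size_prod_XsubC s id) /= -tE.
by rewrite size_polyDl.
Qed.

(** By the strict parallelogram inequality at least one of the two perturbations raises the energy;
    its roots form [t], and [c] is 1 or -1. *)
Lemma two_sided_direction_increase (s : seq C) (g : {poly C}) :
  two_sided_direction s g -> exists t : seq C,
    [/\ size t = size s, (forall z, z \in t -> 0 <= complex.Im z),
      (exists c, root_prod t = root_prod s + c *: g) &
      coef_energy (size s) (root_prod s) < coef_energy (size s) (root_prod t)].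
Proof.
move=> [g0 gs gr]; have := coef_energy_parallelogram (root_prod s) g0 gs.
have [|t tE ts] := @monic_perturb_root_prod s (- g).
  by rewrite size_polyN.
have [u uE us] := monic_perturb_root_prod gs.
case: (ltP (coef_energy (size s) (root_prod s))
           (coef_energy (size s) (root_prod s + g))) => [lt _|le lt2].
  exists u; split; rewrite -?uE //; last by exists 1; rewrite scale1r.
  by move=> z zu; apply: gr; rewrite uE root_prod_XsubC zu.
exists t; split; rewrite -?tE //; last 2 first.
- by exists (-1); rewrite scaleN1r.
- by move: lt2 le; rewrite mulr2n; lra.
by move=> z zu; apply: gr; rewrite tE root_prod_XsubC zu orbT.
Qed.

(** The last clause is Newton's identity for the sum of squares; the first one serves the
    induction. *)
Lemma root_prod_power_sums (s : seq C) :
  let p := 'X^2 * root_prod s in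
  [/\ p`_(size s).+2 = 1, p`_(size s).+1 = - \sum_(x <- s) x &
    \sum_(x <- s) x ^+ 2 = p`_(size s).+1 ^+ 2 - p`_(size s) *+ 2].
Proof.
elim: s => [|x s [p2 p1 p0]] /=.
  rewrite !big_nil mulr1 !coefXn /= oppr0; split=> //.
  by rewrite expr0n mul0rn subrr.
rewrite !big_cons mulrCA; set p := _ * root_prod s in p0 p1 p2 *.
rewrite !mulrBl !coefB !coefXM !coefCM /= p2.
have -> : p`_(size s).+3 = 0.
  rewrite /p mulrC coefMXn /= nth_default // size_prod_XsubC.
  by rewrite !subSS subn0.
rewrite p0 p1; split; ring.
Qed.

End Descent.

(** * Compactness of the fibers in the space of root vectors *)

Section Compactness.
Variable R : realType.
Local Notation C := R[i].

Definition complex_continuous (T : topologicalType) (f : T -> C) : Prop :=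
  continuous (fun x => complex.Re (f x)) /\
  continuous (fun x => complex.Im (f x)).

Section ComplexContinuous.
Variable T : topologicalType.
Implicit Types f g : T -> C.

Lemma complex_continuous_cst c : complex_continuous (fun _ : T => c).
Proof. by split=> x; apply: cst_continuous. Qed.

Lemma complex_continuousD f g : complex_continuous f -> complex_continuous g ->
  complex_continuous (fun x => f x + g x).
Proof.
move=> [fr fi] [gr gi]; split=> x.
  have -> : (fun x => complex.Re (f x + g x)) =
      (fun x => complex.Re (f x)) + (fun x => complex.Re (g x)).
    by apply/funext => y; rewrite !fctE; case: (f y) (g y) => [a b] [c d].
  by apply: continuousD; [exact: fr|exact: gr].
have -> : (fun x => complex.Im (f x + g x)) =
    (fun x => complex.Im (f x)) + (fun x => complex.Im (g x)).
  by apply/funext => y; rewrite !fctE; case: (f y) (g y) => [a b] [c d].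
by apply: continuousD; [exact: fi|exact: gi].
Qed.

Lemma complex_continuousM f g : complex_continuous f -> complex_continuous g ->
  complex_continuous (fun x => f x * g x).
Proof.
move=> [fr fi] [gr gi]; split=> x.
  have -> : (fun x => complex.Re (f x * g x)) =
      (fun x => complex.Re (f x)) \* (fun x => complex.Re (g x)) -
      (fun x => complex.Im (f x)) \* (fun x => complex.Im (g x)).
    by apply/funext => y; rewrite !fctE /=; case: (f y) (g y) => [a b] [c d].
  by apply: continuousB; apply: continuousM;
    [exact: fr|exact: gr|exact: fi|exact: gi].
have -> : (fun x => complex.Im (f x * g x)) =
    (fun x => complex.Re (f x)) \* (fun x => complex.Im (g x)) +
    (fun x => complex.Im (f x)) \* (fun x => complex.Re (g x)).
  by apply/funext => y; rewrite !fctE /=; case: (f y) (g y) => [a b] [c d].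
by apply: continuousD; apply: continuousM;
  [exact: fr|exact: gi|exact: fi|exact: gr].
Qed.

Lemma complex_continuous_sum (I : Type) (r : seq I) (F : I -> T -> C) :
  (forall i, complex_continuous (F i)) ->
  complex_continuous (fun x => \sum_(i <- r) F i x).
Proof.
move=> Fc; elim: r => [|i r IHr].
  under [X in complex_continuous X]eq_fun do rewrite big_nil.
  exact: complex_continuous_cst.
under [X in complex_continuous X]eq_fun do rewrite big_cons.
exact: complex_continuousD.
Qed.

Lemma complex_continuous_closed_fiber f c : complex_continuous f ->
  closed [set x | f x = c].
Proof.
move=> [/continuous_closedP fr /continuous_closedP fi].
have -> : [set x | f x = c] =
    ((fun x => complex.Re (f x)) @^-1` [set y | y = complex.Re c]) `&`
    ((fun x => complex.Im (f x)) @^-1` [set y | y = complex.Im c]).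
  apply/seteqP; split => x /=; first by move=> ->.
  by case: (f x) c => [a b] [c d] /= [-> ->].
by apply: closedI; [apply: fr|apply: fi]; apply: closed_eq.
Qed.

Lemma complex_continuous_sqnorm f : complex_continuous f ->
  continuous (fun x => sqnorm (f x)).
Proof.
move=> [fr fi] x; rewrite /sqnorm.
have -> : (fun x => complex.Re (f x) ^+ 2 + complex.Im (f x) ^+ 2) =
   (fun x => complex.Re (f x)) \* (fun x => complex.Re (f x)) +
   (fun x => complex.Im (f x)) \* (fun x => complex.Im (f x)).
  by apply/funext => y; rewrite !fctE.
by apply: continuousD; apply: continuousM;
  [exact: fr|exact: fr|exact: fi|exact: fi].
Qed.

Lemma continuous_sum_real (I : Type) (r : seq I) (F : I -> T -> R) :
  (forall i, continuous (F i)) -> continuous (fun x => \sum_(i <- r) F i x).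
Proof.
move=> Fc; elim: r => [|i r IHr] x.
  under [X in continuous_at _ X]eq_fun do rewrite big_nil.
  exact: cst_continuous.
under [X in continuous_at _ X]eq_fun do rewrite big_cons.
by apply: (@continuousD _ _ _ (F i)); [exact: Fc|exact: IHr].
Qed.

Lemma complex_continuous_coef_root_prod (I : Type) (r : seq I)
    (F : I -> T -> C) (j : nat) :
  (forall i, complex_continuous (F i)) ->
  complex_continuous (fun x => (\prod_(i <- r) ('X - (F i x)%:P))`_j).
Proof.
move=> Fc; elim: r j => [|i r IHr] j.
  under [X in complex_continuous X]eq_fun do rewrite big_nil.
  exact: complex_continuous_cst.
under [X in complex_continuous X]eq_fun
  do rewrite big_cons mulrBl coefB coefXM coefCM -mulN1r mulrA.
apply: complex_continuousD.
  by case: j => [|j]; [exact: complex_continuous_cst|exact: IHr].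
apply: complex_continuousM => //; apply: complex_continuousM => //.
exact: complex_continuous_cst.
Qed.

End ComplexContinuous.

Lemma sum_Im (s : seq C) :
  complex.Im (\sum_(z <- s) z) = \sum_(z <- s) complex.Im z.
Proof. by apply: (big_morph (@complex.Im R)) => // -[a b] [c d]. Qed.

Lemma sum_Re_sqr (s : seq C) : complex.Re (\sum_(z <- s) z ^+ 2) =
  \sum_(z <- s) (complex.Re z ^+ 2 - complex.Im z ^+ 2).
Proof.
rewrite (big_morph (@complex.Re R) (id1 := 0) (op1 := +%R)) //; last first.
  by move=> [a b] [c d].
by apply: eq_bigr => -[a b] _.
Qed.

(** Nonnegative imaginary parts are each at most their sum [y1]. The squared real parts sum to [x2]
    plus the squared imaginary parts, each at most [y1 ^+ 2]. *)
Lemma bounded_by_power_sums (s : seq C) :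
  (forall z, z \in s -> 0 <= complex.Im z) ->
  let y1 := complex.Im (\sum_(z <- s) z) in
  let x2 := complex.Re (\sum_(z <- s) z ^+ 2) in
  forall z, z \in s -> complex.Im z <= y1 /\
    complex.Re z ^+ 2 <= x2 + (y1 ^+ 2) *+ size s.
Proof.
move=> s0 y1 x2; have le1 z : z \in s -> complex.Im z <= y1.
  move=> zs; rewrite /y1 sum_Im (big_rem z) //= lerDl big_seq sumr_ge0 // => u.
  by move/mem_rem/s0.
move=> z zs; split; first exact: le1.
have sR : \sum_(z <- s) complex.Re z ^+ 2 =
    x2 + \sum_(z <- s) complex.Im z ^+ 2.
  by rewrite /x2 sum_Re_sqr sumrB subrK.
have sI : \sum_(z <- s) complex.Im z ^+ 2 <= y1 ^+ 2 *+ size s.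
  have -> : y1 ^+ 2 *+ size s = \sum_(z <- s) y1 ^+ 2.
    by rewrite big_const_seq count_predT iter_addr_0.
  rewrite !big_seq; apply: ler_sum => u us.
  have y0 : 0 <= y1 by apply: le_trans (s0 u us) (le1 u us).
  by apply: lerXn2r; rewrite ?nnegrE //; [exact: s0|exact: le1].
have : complex.Re z ^+ 2 <= \sum_(z <- s) complex.Re z ^+ 2.
  by rewrite (big_rem z) //= lerDl sumr_ge0 // => u _; rewrite sqr_ge0.
by rewrite sR; lra.
Qed.

(** Real parts come first, then imaginary parts; root lists thus live in a real space of dimension
    [n + n], where closed bounded sets are compact. *)
Definition points (n : nat) (v : 'rV[R]_(n + n)) : seq C :=
  [seq v 0 (lshift n i) +i* v 0 (rshift n i) | i <- enum 'I_n].

Lemma size_points n (v : 'rV[R]_(n + n)) : size (points v) = n.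
Proof. by rewrite size_map size_enum_ord. Qed.

Lemma points_surj n (s : seq C) : size s = n ->
  exists v : 'rV[R]_(n + n), points v = s.
Proof.
move=> sn; exists (row_mx (\row_i complex.Re s`_i) (\row_i complex.Im s`_i)).
apply: (@eq_from_nth _ 0); rewrite size_points // => i ilt.
rewrite (nth_map (Ordinal ilt)) ?size_enum_ord //.
by rewrite row_mxEl row_mxEr !mxE nth_enum_ord //; case: (s`_i).
Qed.

Lemma bounded_closed_fiber_compact n (A : set 'rV[R]_(n + n)) (B : R) :
  closed A ->
  (forall v, A v -> forall z, z \in points v ->
     `|complex.Re z| <= B /\ `|complex.Im z| <= B) ->
  compact A.
Proof.
move=> Ac AB; pose box := [set v : 'rV[R]_(n + n) |
  forall i, `[- B, B]%classic (v ord0 i)].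
apply: (@subclosed_compact _ A box) => //.
  apply: (@rV_compact _ _ (fun=> `[- B, B]%classic)) => i.
  exact: segment_compact.
move=> v Av i /=; rewrite in_itv /= -ler_norml.
have mem j : v 0 (lshift n j) +i* v 0 (rshift n j) \in points v.
  by apply/mapP; exists j; rewrite ?mem_enum.
by case: (split_ordP i) => j ->; have [] := AB v Av _ (mem j).
Qed.

Section Fiber.
Variables (n K : nat) (L : {linear {poly C} -> 'rV[C]_K}) (c : 'rV[C]_K).

Definition stable_fiber : set (seq C) :=
  [set s | [/\ size s = n, forall z, z \in s -> 0 <= complex.Im z &
             L (root_prod s) = c]].

Lemma complex_continuous_points_coef j :
  complex_continuous (fun v : 'rV[R]_(n + n) => (root_prod (points v))`_j).
Proof.
under [X in complex_continuous X]eq_fun do rewrite /points big_map.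
apply: complex_continuous_coef_root_prod => i.
by split=> v; apply: coord_continuous.
Qed.

Lemma complex_continuous_points_linear q :
  complex_continuous (fun v : 'rV[R]_(n + n) => L (root_prod (points v)) 0 q).
Proof.
have -> : (fun v : 'rV[R]_(n + n) => L (root_prod (points v)) 0 q) =
    (fun v => \sum_(j < n.+1) (root_prod (points v))`_j * L 'X^j 0 q).
  apply/funext => v; rewrite -[X in L X](coefK (root_prod _)) poly_def.
  rewrite size_prod_XsubC size_points linear_sum summxE.
  by apply: eq_bigr => j _; rewrite linearZ /= mxE.
apply: complex_continuous_sum => j; apply: complex_continuousM.
  exact: complex_continuous_points_coef.
exact: complex_continuous_cst.
Qed.

Lemma stable_fiber_closed : closed [set v | stable_fiber (@points n v)].
Proof.
have -> : [set v | stable_fiber (@points n v)] =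
    (\bigcap_(i in [set: 'I_n])
       ((fun v : 'rV[R]_(n + n) => v 0 (rshift n i)) @^-1`
          [set y | 0 <= y])) `&`
    (\bigcap_(q in [set: 'I_K])
       [set v | L (root_prod (points v)) 0 q = c 0 q]).
  apply/seteqP; split => v /=.
    move=> [_ v0 vc]; split=> [i _ /=|q _]; last by rewrite /= vc.
    by apply: (v0 (_ +i* _)); apply/mapP; exists i; rewrite ?mem_enum.
  move=> [v0 vc]; split; first exact: size_points.
    by move=> z /mapP[i _ ->]; apply: v0.
  by apply/rowP => q; apply: vc.
apply: closedI; apply: closed_bigI => i _.
  have /continuous_closedP := @coord_continuous R 1 (n + n) 0 (rshift n i).
  by apply; apply: closed_ge.
exact/complex_continuous_closed_fiber/complex_continuous_points_linear.
Qed.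

(* [d] and [e] are the coefficients of [X^(n-1)] and [X^(n-2)], read off
   [X^2 * root_prod s] so that they make sense when [n < 2]. *)
Lemma stable_fiber_energy_max (d e : C) :
  (forall s, stable_fiber s -> ('X^2 * root_prod s)`_n.+1 = d /\
     ('X^2 * root_prod s)`_n = e) ->
  stable_fiber !=set0 ->
  exists2 s, stable_fiber s & forall t, stable_fiber t ->
    coef_energy n (root_prod t) <= coef_energy n (root_prod s).
Proof.
move=> Lde [s sS].
pose A := [set v | stable_fiber (@points n v)].
have A0 : A !=set0.
  have [sn _ _] := sS; have [v vs] := points_surj sn.
  by exists v; rewrite /A /= vs.
(* Imaginary part of the sum of the roots and real part of the sum of their squares, read off [d]
   and [e] by Newton's identity. *)
pose y1 := complex.Im (- d); pose x2 := complex.Re (d ^+ 2 - e *+ 2).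
pose T := x2 + y1 ^+ 2 *+ n.
have Ac : compact A.
  (* [T] bounds the squared real parts, and [u^2 <= T] implies [|u| <= 1 + |T|]; the summand [|y1|]
     covers the imaginary parts. *)
  apply: (@bounded_closed_fiber_compact _ _ (`|y1| + (1 + `|T|))).
    exact: stable_fiber_closed.
  move=> v Av z zv; have [_ v0 _] := Av; have [dE eE] := Lde _ Av.
  have := root_prod_power_sums (points v); rewrite /= size_points.
  rewrite dE eE => -[_ s1 s2].
  have sumE : \sum_(x <- points v) x = - d by rewrite s1 opprK.
  have := bounded_by_power_sums v0 zv.
  rewrite /= size_points s2 sumE -/y1 -/x2 -/T => -[yle xle].
  have T0 : T <= `|T| := ler_norm T.
  have Y0 : y1 <= `|y1| := ler_norm y1.
  have Tn := normr_ge0 T; have Yn := normr_ge0 y1; have z0 := v0 _ zv.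
  split; last by rewrite ger0_norm //; lra.
  by rewrite ler_norml; apply/andP; split; nra.
have [|v /set_mem Av vmax] := compact_EVT_max
    (f := fun v => coef_energy n (root_prod (points v))) A0 Ac.
  apply: continuous_subspaceT; apply: continuous_sum_real => i.
  exact/complex_continuous_sqnorm/complex_continuous_points_coef.
exists (points v) => // t tS; have [tn _ _] := tS.
have [w wt] := points_surj tn; rewrite -wt; apply: vmax.
by apply/mem_set; rewrite /A /= wt.
Qed.

End Fiber.

End Compactness.

(** * The extremal argument in the upper half-plane *)

Section HalfPlaneReduction.
Variable R : realType.
Local Notation C := R[i].

Section AppendTopCoefficients.
Variables (n k : nat) (L : {linear {poly C} -> 'rV[C]_k}).

(** The extra entries are the coefficients of [X^(n-2)] and [X^(n-1)], which fix the power sums that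
    bound the fiber; they account for the 2 in [k + 2]. *)
Definition append_top_coefs (p : {poly C}) : 'rV[C]_(k + 2) :=
  row_mx (L p) (\row_(j < 2) ('X^2 * p)`_(n + j)).

Lemma append_top_coefs_is_linear : linear append_top_coefs.
Proof.
move=> a p q; rewrite /append_top_coefs scale_row_mx add_row_mx linearP.
congr row_mx; apply/rowP => j.
by rewrite !mxE mulrDr -scalerAr coefD coefZ.
Qed.

HB.instance Definition _ := GRing.isLinear.Build C {poly C} 'rV[C]_(k + 2) _
  append_top_coefs append_top_coefs_is_linear.

End AppendTopCoefficients.

Lemma upper_half_plane_reduction (k : nat) (L : {linear {poly C} -> 'rV[C]_k})
    (s : seq C) :
  (forall z, z \in s -> 0 <= complex.Im z) ->
  exists t : seq C,
    [/\ size t = size s, forall z, z \in t -> 0 <= complex.Im z,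
      L (root_prod t) = L (root_prod s),
      (size (undup [seq z <- t | complex.Im z == 0%R]) <= 2 * (k + 2))%N &
      (count (fun z : C => (0 < complex.Im z)%R) t <= k + 2)%N].
Proof.
move=> s0; pose n := size s.
pose L' : {linear {poly C} -> 'rV[C]_(k + 2)} := append_top_coefs n L.
pose c := L' (root_prod s).
have [||t [tn t0 tc] tmax] := @stable_fiber_energy_max R n _ L' c
    ('X^2 * root_prod s)`_n.+1 ('X^2 * root_prod s)`_n.
- move=> u [_ _ /eq_row_mx[_ /rowP uc]].
  by have := uc 0; have := uc 1; rewrite !mxE /= addn0 addn1.
- by exists s.
(* A two-sided direction killed by [L'] would lead to a point of the same fiber with more energy
   than the maximizer [t]. *)
have nodir g : two_sided_direction t g -> L' g <> 0.
  move=> /two_sided_direction_increase[u [us u0 [a uE] lt_tu]] g0.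
  rewrite tn in us lt_tu.
  have : stable_fiber n L' c u.
    by split=> //; rewrite uE linearD linearZ_LR g0 scaler0 addr0.
  by move/tmax; rewrite leNgt lt_tu.
exists t; split=> //.
- by have /eq_row_mx[] := tc.
- rewrite leqNgt; apply/negP => /(@boundary_direction _ _ L' _ t0)[g gd].
  exact: nodir.
- rewrite leqNgt; apply/negP => /(@interior_direction _ _ L' _ t0)[g gd].
  exact: nodir.
Qed.

End HalfPlaneReduction.

(** * Linear forms in the elementary symmetric polynomials, as linear maps on coefficients *)

Section ElementarySymmetric.

Lemma meval_dhomog1 (F : comNzRingType) (n : nat) (p : {mpoly F[n]})
    (v : 'I_n -> F) :
  p \is 1.-homog -> p.@[v] = \sum_j p@_U_(j) * v j.
Proof.
move=> hp; have {1}-> : p = \sum_j p@_U_(j) *: 'X_j.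
  apply/mpolyP => m; rewrite raddf_sum /=.
  under eq_bigr => j _ do rewrite mcoeffZ mcoeffX.
  have [/eqP/mdeg1P[i /eqP ->]|m1] := eqVneq (mdeg m) 1%N; last first.
    rewrite (dhomog_nemf_coeff hp m1) big1 // => j _.
    case: eqP => [jm|]; last by rewrite mulr0.
    by rewrite -jm mdeg1 in m1.
  rewrite (bigD1 i) //= eqxx mulr1 big1 ?addr0 // => j ji.
  by rewrite eq_mnm1 (negPf ji) mulr0.
rewrite raddf_sum /=; apply: eq_bigr => j _.
by rewrite mevalZ mevalXU.
Qed.

Variables (R : realType) (n k : nat) (l : k.-tuple {mpoly R[i][n]}).
Variables (al be : R[i]).
Local Notation C := R[i].

(* The values of the linear forms [l] at the elementary symmetric polynomials
   of the points [(w - be) / al], [w] running over the roots of [p]. *)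
Definition forms_at_roots (p : {poly C}) : 'rV[C]_k :=
  \row_q \sum_(j < n) (tnth l q)@_U_(j) *
    ((-1) ^+ j.+1 * (al ^- n * (p \Po (al *: 'X + be%:P))`_(n - j.+1))).

Lemma forms_at_roots_is_linear : linear forms_at_roots.
Proof.
move=> a p q; apply/rowP => i; rewrite !mxE mulr_sumr -big_split /=.
apply: eq_bigr => j _; rewrite comp_polyD comp_polyZ coefD coefZ.
ring.
Qed.

HB.instance Definition _ := GRing.isLinear.Build C {poly C} 'rV[C]_k _
  forms_at_roots forms_at_roots_is_linear.

(** Substituting [al X + be] into the product over the [al * z + be] gives [al^n] times the product
    over the [z], whose coefficients are the signed elementary symmetric polynomials. *)
Lemma forms_at_rootsE (x : n.-tuple C) (q : 'I_k) :
  (forall i, tnth l i \is 1.-homog) -> al != 0 ->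
  forms_at_roots (root_prod [seq al * z + be | z <- x]) 0 q =
  (tnth l q \mPo elem_sym_tuple R n).@[tnth x].
Proof.
move=> hl al0; rewrite comp_mpoly_meval (meval_dhomog1 _ (hl q)) mxE.
apply: eq_bigr => j _; congr (_ * _).
rewrite tnth_mktuple /=.
have := @mroots_coeff _ _ x (lift ord0 j); rewrite /= /bump /= add1n => xE.
have -> : root_prod [seq al * z + be | z <- x] \Po (al *: 'X + be%:P) =
    al ^+ n *: root_prod x.
  rewrite -[in al ^+ n](size_tuple x); elim: (val x) => [|z s IHs] /=.
    by rewrite !big_nil comp_polyC scale1r.
  rewrite !big_cons comp_polyM IHs comp_polyB comp_polyX comp_polyC.
  rewrite polyCD polyCM -!mul_polyC exprS polyCM; ring.
rewrite coefZ xE mulKf ?expf_neq0 // mulrA -exprD addnn.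
by rewrite -signr_odd odd_double mul1r.
Qed.

End ElementarySymmetric.

(** * Transfer to an arbitrary half-plane *)

Lemma half_plane_reduction (R : realType) (n k : nat) (H : half_plane R)
    (l : k.-tuple {mpoly R[i][n]}) (x : n.-tuple R[i]) :
  (forall i, tnth l i \is 1.-homog) -> hp_power H x ->
  exists2 y : n.-tuple R[i], hp_bounded H (2 * (k + 2)) (k + 2) y &
    forall q, (tnth l q \mPo elem_sym_tuple R n).@[tnth y] =
              (tnth l q \mPo elem_sym_tuple R n).@[tnth x].
Proof.
move=> hl xH; have a0 := hp_coef_neq0 H.
(* The factor ['i] turns real parts into imaginary parts, so [z] lies in [H] exactly when
   [al * z + be] has nonnegative imaginary part. *)
pose al := 'i * hp_coef H; pose be := - ('i * (hp_level H)%:C).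
have al0 : al != 0.
  by rewrite mulf_neq0 // eq_complex /= negb_and oner_eq0 orbT.
pose f z := al * z + be.
have Imf z : complex.Im (f z) = complex.Re (hp_coef H * z) - hp_level H.
  rewrite /f /al /be -mulrA; case: (hp_coef H * z) => u v /=; ring.
have f_bij : cancel (fun w => (w - be) / al) f.
  by move=> w; rewrite /f mulrC divfK // subrK.
have f_inj : injective f by move=> u v /addIr/(mulfI al0).
have [|t [ts t0 tL tb ti]] :=
    @upper_half_plane_reduction R k (forms_at_roots l al be) (map f x).
  move=> _ /mapP[z /tnthP[j ->] ->]; rewrite Imf subr_ge0; exact: xH.
rewrite size_map size_tuple in ts.
have ys : size [seq (w - be) / al | w <- t] == n by rewrite size_map ts.
pose y := Tuple ys.
have tE : t = map f y by rewrite /= -map_comp map_id_in // => w _; apply: f_bij.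
exists y; last first.
  move=> q; rewrite -!(forms_at_rootsE be _ _ hl al0).
  by rewrite -[[seq _ | z <- y]]/(map f y) -tE tL.
split.
- move=> j; rewrite /hp_set /= -subr_ge0 -Imf; apply: t0.
  by rewrite tE map_f // mem_tnth.
- have bdE z : (complex.Im (f z) == 0) = (z \in hp_bd H).
    rewrite Imf subr_eq0.
    by apply/eqP/idP => [|/set_mem //]; apply: mem_set.
  by move: tb; rewrite tE filter_map undup_map_inj // size_map (eq_filter bdE).
move: ti; rewrite tE count_map -sum1_count big_tuple sum1dep_card.
apply: leq_trans; apply: subset_leq_card; apply/fintype.subsetP => j.
by rewrite !finset.in_set => /set_mem; rewrite /hp_int /= -/(f _) Imf subr_gt0.
Qed.

Theorem proposition2p14 (R : realType) (n k : nat) (hk : (1 <= k)%N)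
    (hkn : (k <= n)%N) (H : half_plane R) (l : k.-tuple {mpoly R[i][n]})
    (hl : forall i : 'I_k, tnth l i \is 1.-homog)
    (V : set (n.-tuple R[i]))
    (hV : exists F : set {mpoly R[i][n]},
        (forall f, F f -> sufficient l f) /\ V = zero_locus F) :
  V `&` @hp_power R n H = set0 <->
  V `&` @hp_bounded R n H (2 * (k + 2)) (k + 2) = set0.
Proof.
case: hV => F [Fl ->]; split=> V0; apply/seteqP; split=> x //.
  by move=> [xV [xH _ _]]; rewrite -V0.
move=> [xV xH]; have [y yH yE] := half_plane_reduction hl xH.
suff : set0 y by [].
rewrite -V0; split=> // f Ff; rewrite -(xV f Ff).
(* [f] is a polynomial in the forms [l] taken at the elementary symmetric polynomials, and the
   values of these forms agree at [x] and [y]. *)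
have [_ [g [-> [h _ <-]]]] := Fl f Ff.
rewrite !comp_mpoly_meval; apply: meval_eq => q.
by have := yE q; rewrite !comp_mpoly_meval.
Qed.
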